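(* Let $G:\mathbb{C}\to\mathbb{C}^{m\times m}$ be a discrete-time, symmetric, real, rational, proper transfer function with no poles at $z=-1$. Then $G(z)$ is D-NI if and only if $$F(z)=\frac{z-1}{z+1}\,\big[G(z)-G(-1)\big]$$ is D-PR and $G(\infty)=G(\infty)^\top$.
   Context: $i$ is the imaginary unit; $A^*$ is the conjugate transpose and $A^\top$ the transpose; $\ge0$ (likewise $\le0$) denotes positive semidefiniteness of Hermitian matrices. A rational transfer function is real if its entries are rational functions with real coefficients, symmetric if $G(z)=G(z)^\top$, and proper if $G(\infty)$ is finite. D-NI (discrete negative imaginary): a real transfer function $G$ that is analytic in $\{|z|>1\}$ and such that, for all $z$ with $|z|>1$: $i[G(z)-G(z)^*]\ge0$ if $\mathrm{Im}\,z>0$; $i[G(z)-G(z)^*]=0$ if $\mathrm{Im}\,z=0$; $i[G(z)-G(z)^*]\le0$ if $\mathrm{Im}\,z<0$. D-PR (discrete positive real): $F(z)$ is analytic in $\{|z|>1\}$; $F(z)$ is real when $z$ is real and positive; and $F(z)^*+F(z)\ge0$ for all $|z|>1$. *)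

(* Defs.v *)
From HB Require Import structures.
From mathcomp Require Import all_boot all_order all_algebra.
From mathcomp Require Import sesquilinear spectral fraction generic_quotient.
From mathcomp Require Import complex.
From mathcomp Require Import all_classical all_reals all_analysis.
Import Order.TTheory GRing.Theory Num.Theory.
Import numFieldNormedType.Exports.
Set Implicit Arguments.
Unset Strict Implicit.
Unset Printing Implicit Defensive.
Local Open Scope ring_scope.
Local Open Scope classical_set_scope.
Local Open Scope sesquilinear_scope.

(* Every structure on the complex numbers is inferred from this single
   numClosedFieldType instance. *)
Definition complexes (R : realType) : numClosedFieldType := R[i].

Notation ratfun K := {fraction {poly K}}.

Definition ratfrac (K : fieldType) (p q : {poly K}) : ratfun K :=
  FracField.tofrac p / FracField.tofrac q.

Definition ratconst (K : fieldType) (c : K) : ratfun K :=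
  FracField.tofrac c%:P.

(* repr need not be in lowest terms, hence the division by the gcd; the
   reduced numerator and denominator are canonical up to a common nonzero
   scalar. *)
Definition ratnum (K : fieldType) (f : ratfun K) : {poly K} :=
  let x := frac (repr f) in x.1 %/ gcdp x.1 x.2.

Definition ratden (K : fieldType) (f : ratfun K) : {poly K} :=
  let x := frac (repr f) in x.2 %/ gcdp x.1 x.2.

Definition ratpole (K : fieldType) (f : ratfun K) (z : K) : bool :=
  root (ratden f) z.

(* The value at a pole is the junk value 0. *)
Definition ratval (K : fieldType) (f : ratfun K) (z : K) : K :=
  (ratnum f).[z] / (ratden f).[z].

Definition ratreal (C : numClosedFieldType) (f : ratfun C) : Prop :=
  exists p q : {poly C}, [/\ p \is a polyOver Num.real,
    q \is a polyOver Num.real, q != 0 & f = ratfrac p q].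

(* z --> oo on the Riemann sphere is rendered as z = w^-1 with w --> 0,
   w != 0. *)
Definition ratfun_at_infty (C : numClosedFieldType) (f : ratfun C) :
    set_system C^o :=
  (fun w : C^o => ratval f w^-1 : C^o) @ (0 : C^o)^'.

(* Analyticity is complex differentiability of the evaluation map at every
   point of {|z| > 1}; it fails at a pole, where ratval is unbounded nearby. *)
Definition analytic_exterior (C : numClosedFieldType) (f : ratfun C) : Prop :=
  forall z : C, 1 < `|z| ->
    derivable (fun w : C^o => ratval f w : C^o) (z : C^o) 1.

Notation ratmx K m := 'M[ratfun K]_m.

Definition mxval (K : fieldType) (m : nat) (G : ratmx K m) (z : K) : 'M[K]_m :=
  map_mx (fun f => ratval f z) G.

Definition mxpole (K : fieldType) (m : nat) (G : ratmx K m) (z : K) : bool :=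
  [exists i, exists j, ratpole (G i j) z].

Definition mxreal (C : numClosedFieldType) (m : nat) (G : ratmx C m) : Prop :=
  forall i j, ratreal (G i j).

Definition mxsymmetric (K : fieldType) (m : nat) (G : ratmx K m) : Prop :=
  G = G^T.

Definition mxproper (C : numClosedFieldType) (m : nat) (G : ratmx C m) : Prop :=
  forall i j, cvg (ratfun_at_infty (G i j)).

Definition mxval_infty (C : numClosedFieldType) (m : nat) (G : ratmx C m) :
    'M[C]_m :=
  \matrix_(i, j) (lim (ratfun_at_infty (G i j)) : C).

Definition mxanalytic (C : numClosedFieldType) (m : nat) (G : ratmx C m) :
    Prop :=
  forall i j, analytic_exterior (G i j).

(* In C, 0 <= x means that x is real and nonnegative. *)
Definition psdmx (C : numClosedFieldType) (m : nat) (A : 'M[C]_m) : Prop :=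
  A \is hermsymmx /\ forall v : 'cV[C]_m, 0 <= (v ^t* *m A *m v) 0 0.

Definition nsdmx (C : numClosedFieldType) (m : nat) (A : 'M[C]_m) : Prop :=
  psdmx (- A).

Definition DNI (C : numClosedFieldType) (m : nat) (G : ratmx C m) : Prop :=
  [/\ mxreal G, mxanalytic G &
    forall z : C, 1 < `|z| ->
      let D := 'i *: (mxval G z - (mxval G z) ^t*) in
      [/\ 0 < 'Im z -> psdmx D, 'Im z = 0 -> D = 0 & 'Im z < 0 -> nsdmx D]].

(* 0 < x in C says that x is real and positive; F may have poles on ]0, 1],
   where it has no value. *)
Definition DPR (C : numClosedFieldType) (m : nat) (F : ratmx C m) : Prop :=
  [/\ mxanalytic F,
    forall x : C, 0 < x -> ~~ mxpole F x -> mxval F x \is a realmx &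
    forall z : C, 1 < `|z| -> psdmx ((mxval F z) ^t* + mxval F z)].

(* Main.v *)
Require Import Defs.
From mathcomp Require Import all_boot all_order all_algebra.
From mathcomp Require Import sesquilinear spectral fraction generic_quotient.
From mathcomp Require Import complex.
From mathcomp Require Import all_classical all_reals all_analysis.
From mathcomp Require Import ring lra.
Import Order.TTheory GRing.Theory Num.Theory.
Import numFieldNormedType.Exports.
Set Implicit Arguments.
Unset Strict Implicit.
Unset Printing Implicit Defensive.
Local Open Scope ring_scope.
Local Open Scope classical_set_scope.
Local Open Scope sesquilinear_scope.

(** Write s = (z - 1)/(z + 1), so that |z| > 1 becomes the right half plane
Re s > 0, with Im s of the sign of Im z and z = -1 sent to infinity, and put
H = G - G(-1), so that F = s H.

Reduction to scalars.  As G is symmetric, i (G - G^* ) = -2 Im G and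
F + F^* = 2 Re F are real symmetric matrices, whose positivity is tested on real
vectors u ([psdmx_Im_leP], [psdmx_Re_geP]).  Both properties therefore
concern the scalar rational functions h = u^T H u, which are real and vanish at
z = -1: the claim is that Im h <= 0 on the open first quadrant of the s-plane
if and only if Re (s h) >= 0 on the right half plane.  A complex derivative
cannot exist at a pole, so analyticity outside the disc only says that there
are no poles, and F and G have the same poles there.  In the coordinate
w = 1/z all these functions are quotients of polynomials whose denominator has
no root in the open unit disc, the origin being covered by properness
([ratval_inv_disc]).

Both directions rest on the minimum principle for the real part of such a
quotient on a closed disc ([Re_ratio_disc_min_principle]): near an interior
point a nonconstant quotient is its value plus t (w - a)^n with t nonzero, so
some direction makes the real part smaller.

Negative imaginary implies positive real ([disc_NI_PR]).  For e > 0 consider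
(s - e) h on the half plane Re s >= e.  On the line s = e + i y it equals
i y h, with real part - y Im h >= 0, and it has no poles, not even at
infinity because h vanishes there.  So its real part is nonnegative on
Re s >= e; let e tend to 0.  Staying inside the half plane avoids any
discussion of the poles of G on the unit circle.  In the coordinate w the half
plane is a disc internally tangent to the unit circle at -1.

Positive real implies negative imaginary ([disc_PR_NI]).  By the Schwarz-Pick
inequality at the conjugate points a and a^*, where f = s h takes conjugate
values, |Im f| / |f| <= |Im s| / |s|.  Since Re f and Re s are nonnegative this says
|arg f| <= |arg s|, so f / s = h has imaginary part of the sign opposite to
that of Im s ([exterior_PR_NI]). *)

(** * Local behaviour of quotients of polynomials *)

Section RatTopology.
Variable K : numClosedFieldType.
Implicit Types (p q : {poly K}) (f : ratfun K) (a z : K).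

Lemma derivable_poly p (z : K^o) :
  derivable (fun w : K^o => p.[w] : K^o) z 1.
Proof.
elim/poly_ind: p => [|p c IH].
  by under eq_fun do rewrite horner0; exact: derivable_cst.
under eq_fun do rewrite hornerMXaddC.
apply: derivableD; last exact: derivable_cst.
by apply: (@derivableM K K^o) => //; exact: derivable_id.
Qed.

Lemma continuous_poly p : continuous (fun w : K^o => p.[w] : K^o).
Proof.
move=> z; apply: differentiable_continuous.
by apply/derivable1_diffP/derivable_poly.
Qed.

Lemma continuous_ratio p q (a : K^o) : q.[a] != 0 ->
  {for a, continuous (fun w : K^o => p.[w] / q.[w] : K^o)}.
Proof.
move=> qa0; apply: (@continuousM K K^o); first exact: continuous_poly.
by apply: (@continuousV K K^o) => //; exact: continuous_poly.
Qed.

Lemma near_nonroot q (a : K^o) : q.[a] != 0 -> \forall w \near a, q.[w] != 0.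
Proof.
rewrite -normr_gt0 => qa0; have := @continuous_poly q a.
move=> /cvgrPdist_lt/(_ _ qa0).
apply: filterS => w; apply: contraTneq => ->.
by rewrite subr0 ltxx.
Qed.

Lemma near_dnbhs_nonroot q (a : K^o) : q != 0 ->
  \forall w \near a^', q.[w : K] != 0.
Proof.
move=> q0; have [n [r ra0 qE]] := multiplicity_XsubC q a.
rewrite q0 /= in ra0; have {}ra0 : r.[a] != 0 by [].
near=> w; rewrite qE !hornerE mulf_neq0 ?expf_neq0 ?subr_eq0//.
  near: w; apply: cvg_within; exact: near_nonroot.
by near: w; exact: nbhs_dnbhs_neq.
Unshelve. all: by end_near. Qed.

(** Factoring p - f(a) q at its root a gives f(w) = f(a) + (w - a)^n t(w) with
t(a) nonzero; moving in a direction u with u^n t(a) = -1 decreases Re f. *)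
Lemma Re_ratio_descent p q a (e : K) : q.[a] != 0 ->
  p != (p.[a] / q.[a]) *: q -> 0 < e ->
  exists w, [/\ `|w - a| < e, q.[w] != 0 & 'Re (p.[w] / q.[w]) < 'Re (p.[a] / q.[a])].
Proof.
move=> qa0; set c := _ / _ => pNc e0.
have P0 : p - c *: q != 0 by rewrite subr_eq0.
have [n [r]] := multiplicity_XsubC (p - c *: q) a.
rewrite P0 /= => ra0 PE; have {}ra0 : r.[a] != 0 by [].
have n0 : (0 < n)%N.
  rewrite lt0n; apply/eqP => n0; move/eqP: ra0; apply.
  have := congr1 (horner^~ a) PE; rewrite /= n0 expr0 mulr1 => <-.
  by rewrite !hornerE /c divfK// subrr.
pose t := r.[a] / q.[a]; have t0 : t != 0 by rewrite mulf_neq0 ?invr_eq0.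
(* The direction of steepest descent: u ^+ n * t = -1. *)
pose u : K := n.-root (- t^-1).
have un : u ^+ n = - t^-1 by rewrite rootCK.
have nT : 0 < `|t| / 2 by rewrite divr_gt0 ?normr_gt0.
have : \forall w \near (a : K^o), [/\ `|w - a| < e, q.[w] != 0 &
    `|t - r.[w] / q.[w]| < `|t| / 2].
  near=> w; split.
  - by rewrite distrC; near: w; apply/nbhs_normP; exists e.
  - by near: w; exact: near_nonroot.
  - near: w; move/cvgrPdist_lt: (@continuous_ratio r q a qa0); exact.
move=> /nbhs_normP [d /= d0 dP].
have u1 : 0 < 1 + `|u| by rewrite ltr_wpDr.
pose dl := d / (1 + `|u|); have dl0 : 0 < dl by rewrite divr_gt0.
pose w := a + dl * u.
have wad : `|a - w| < d.
  rewrite /w opprD addNKr normrN normrM (gtr0_norm dl0) /dl mulrAC.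
  by rewrite ltr_pdivrMr// ltr_pM2l// ltrDr.
have [we qw tw] := dP w wad; exists w; split=> //.
have E : p.[w] = c * q.[w] + r.[w] * (w - a) ^+ n.
  have := congr1 (horner^~ w) PE; rewrite /= !hornerE => <-.
  by rewrite addrC subrK.
have -> : p.[w] / q.[w] = c + dl ^+ n * (u ^+ n * (r.[w] / q.[w])).
  have wa : w - a = dl * u by rewrite /w addrAC subrr add0r.
  by rewrite E wa mulrDl mulfK// exprMn; ring.
have dlR : dl ^+ n \is Num.real by rewrite rpredX ?gtr0_real.
rewrite raddfD /= gtrDl ReM (Creal_ReP _ dlR) (Creal_ImP _ dlR) mul0r subr0.
rewrite pmulr_rlt0 ?exprn_gt0// un.
have : `|1 + - t^-1 * (r.[w] / q.[w])| < 1 / 2.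
  rewrite -[X in X + _](mulVf t0) mulNr -mulrBr normrM normfV.
  by rewrite ltr_pdivrMl ?normr_gt0// mul1r.
set x := - _ * _ => xlt.
have /le_lt_trans/(_ xlt) : 'Re (1 + x) <= `|1 + x| by rewrite leif_Re_Creal.
rewrite raddfD /= (Creal_ReP 1 _) ?rpred1// -ltrBrDl => /lt_trans; apply.
by rewrite subr_lt0 ltr_pdivrMr// mul1r ltr1n.
Unshelve. all: by end_near. Qed.

(** Near a root of q which is not a root of p the quotient blows up.  This is
the only way in which analyticity and properness exclude poles. *)
Lemma bounded_ratio_nonroot p q a (M : K) : coprimep p q -> q != 0 -> 0 <= M ->
  (\forall w \near (a : K^o)^', `|p.[w : K] / q.[w]| <= M) -> q.[a] != 0.
Proof.
move=> cpq q0 M0 H; apply/negP => /eqP qa.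
have pa0 : p.[a] != 0.
  by apply/negP => pa; have := coprimep_root cpq pa; rewrite qa eqxx.
pose e := `|p.[a]| / 2; have e0 : 0 < e by rewrite divr_gt0 ?normr_gt0.
have M1 : 0 < M + 1 by rewrite ltr_wpDl.
have : \forall w \near (a : K^o)^', False.
  near=> w.
  have H1 : `|p.[a] - p.[w]| < e.
    near: w; apply: cvg_within; move/cvgrPdist_lt: (@continuous_poly p a); exact.
  have H2 : `|q.[a] - q.[w]| < e / (M + 1).
    near: w; apply: cvg_within; move/cvgrPdist_lt: (@continuous_poly q a); apply.
    by rewrite divr_gt0.
  have H3 : `|p.[w] / q.[w]| <= M by near: w.
  have H4 : q.[w] != 0 by near: w; exact: near_dnbhs_nonroot.
  move: H2 H3; rewrite qa sub0r normrN => H2.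
  rewrite normrM normfV ler_pdivrMr ?normr_gt0// => H3.
  have : `|p.[a]| < e + e.
    rewrite -[p.[a]](subrK p.[w]) (le_lt_trans (ler_normD _ _))//.
    rewrite ltrD// (le_lt_trans H3)//.
    rewrite (@le_lt_trans _ _ ((M + 1) * `|q.[w]|))//.
      by rewrite ler_wpM2r// lerDl.
    by rewrite mulrC -ltr_pdivlMr.
  by rewrite /e -splitr ltxx.
by move=> /filter_ex [].
Unshelve. all: by end_near. Qed.

End RatTopology.

(** * Evaluation of rational functions *)

Section RatFun.
Variable K : fieldType.
Implicit Types (p q : {poly K}) (f g : ratfun K) (z : K).

Lemma ratden_neq0 f : ratden f != 0.
Proof.
have d0 := denom_ratioP (repr f); rewrite /ratden divpN0 ?dvdp_gcdr//.
  exact: dvdp_leq (dvdp_gcdr _ _).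
by rewrite gcdp_eq0 negb_and d0 orbT.
Qed.

Lemma coprimep_ratnum_ratden f : coprimep (ratnum f) (ratden f).
Proof. by apply: coprimep_div_gcd; rewrite denom_ratioP orbT. Qed.

Lemma eq_ratfrac p q p' q' : q != 0 -> q' != 0 ->
  (ratfrac p q == ratfrac p' q') = (p * q' == p' * q).
Proof.
by move=> q0 q'0; rewrite /ratfrac eqr_div ?tofrac_eq0// -!tofracM tofrac_eq.
Qed.

Lemma ratfrac_repr f : ratfrac (frac (repr f)).1 (frac (repr f)).2 = f.
Proof.
rewrite -[RHS](reprK f); case: (repr f) => -[p q] /= q0.
rewrite /ratfrac; unlock FracField.tofrac.
rewrite -[X in _ * X]FracField.pi_inv -[LHS]FracField.pi_mul.
rewrite /FracField.mulf /FracField.invf !numden_Ratio ?oner_eq0//.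
by rewrite mulr1 mul1r -[in RHS](Ratio_numden (@mkRatio _ (p, q) q0)).
Qed.

Lemma ratfrac_ratnum_ratden f : ratfrac (ratnum f) (ratden f) = f.
Proof.
rewrite -[RHS]ratfrac_repr; apply/eqP; rewrite eq_ratfrac ?ratden_neq0 ?denom_ratioP//.
set x := frac _; rewrite /ratnum /ratden -/x; set g := gcdp _ _.
have E1 : x.1 %/ g * g = x.1 := divpK (dvdp_gcdl _ _).
have E2 : x.2 %/ g * g = x.2 := divpK (dvdp_gcdr _ _).
transitivity (x.1 %/ g * (x.2 %/ g * g) == x.1 * (x.2 %/ g)).
  by rewrite E2.
by rewrite mulrCA E1 mulrC eqxx.
Qed.

(** Any fraction representing f computes its value where the denominator does
not vanish: the reduced denominator divides every other denominator. *)
Lemma ratvalE p q z : q.[z] != 0 ->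
  ~~ ratpole (ratfrac p q) z /\ ratval (ratfrac p q) z = p.[z] / q.[z].
Proof.
move=> qz; set f := ratfrac p q.
have q0 : q != 0 by apply: contraNneq qz => ->; rewrite horner0.
have E : ratnum f * q = p * ratden f.
  by apply/eqP; rewrite -eq_ratfrac ?ratden_neq0// ratfrac_ratnum_ratden.
have dz : (ratden f).[z] != 0.
  have : ratden f %| q.
    rewrite -(@Gauss_dvdpr _ _ (ratnum f)) ?E ?dvdp_mull//.
    by rewrite coprimep_sym coprimep_ratnum_ratden.
  case/dvdpP => r qE; apply: contraNneq qz => dz.
  by rewrite qE hornerM dz mulr0.
split; first by rewrite /ratpole /root.
apply/eqP; rewrite /ratval eqr_div//.
by have := congr1 (horner^~ z) E; rewrite !hornerM => ->.
Qed.

Variant ratrep_spec f z : K -> Prop :=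
  RatRep p q of f = ratfrac p q & q.[z] != 0 : ratrep_spec f z (p.[z] / q.[z]).

Lemma ratrepP f z : ~~ ratpole f z -> ratrep_spec f z (ratval f z).
Proof.
move=> fz; apply: (RatRep _ fz).
by rewrite ratfrac_ratnum_ratden.
Qed.

Lemma ratvalD f g z : ~~ ratpole f z -> ~~ ratpole g z ->
  ~~ ratpole (f + g) z /\ ratval (f + g) z = ratval f z + ratval g z.
Proof.
case/ratrepP => p q fE qz; case/ratrepP => p' q' gE q'z.
have nz (r : {poly K}) : r.[z] != 0 -> FracField.tofrac r != 0.
  by rewrite tofrac_eq0; apply: contraNneq => ->; rewrite horner0.
have -> : f + g = ratfrac (p * q' + p' * q) (q * q').
  by rewrite fE gE /ratfrac addf_div ?nz// -!tofracM -tofracD.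
have [|-> ->] := @ratvalE (p * q' + p' * q) (q * q') z.
  by rewrite hornerM mulf_neq0.
by split=> //; rewrite addf_div// !hornerE.
Qed.

Lemma ratvalM f g z : ~~ ratpole f z -> ~~ ratpole g z ->
  ~~ ratpole (f * g) z /\ ratval (f * g) z = ratval f z * ratval g z.
Proof.
case/ratrepP => p q fE qz; case/ratrepP => p' q' gE q'z.
have -> : f * g = ratfrac (p * p') (q * q').
  by rewrite fE gE /ratfrac mulf_div -!tofracM.
have [|-> ->] := @ratvalE (p * p') (q * q') z.
  by rewrite hornerM mulf_neq0.
by split=> //; rewrite mulf_div !hornerE.
Qed.

Lemma ratval_const c z :
  ~~ ratpole (ratconst c) z /\ ratval (ratconst c) z = c.
Proof.
have -> : ratconst c = ratfrac c%:P 1 by rewrite /ratfrac tofrac1 divr1.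
by have [|-> ->] := @ratvalE c%:P 1 z; rewrite !hornerE ?oner_eq0 ?divr1.
Qed.

End RatFun.

Section RatReal.
Variable K : numClosedFieldType.
Implicit Types (p q : {poly K}) (f g : ratfun K) (z : K).

Lemma polyOver_real_conj p : p \is a polyOver Num.real -> map_poly Num.conj p = p.
Proof.
move=> /polyOverP pR; apply/polyP => i; rewrite coef_map.
exact: conj_Creal.
Qed.

(** The reduced numerator and denominator need not have real coefficients, but
their conjugates still represent f. *)
Lemma ratval_conj f z : ratreal f -> ~~ ratpole f z ->
  ~~ ratpole f z^* /\ ratval f z^* = (ratval f z)^*.
Proof.
move=> [p [q [pR qR q0 fE]]] fz.
pose n := map_poly Num.conj (ratnum f); pose d := map_poly Num.conj (ratden f).
have E : f = ratfrac n d.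
  apply/eqP; rewrite {1}fE eq_ratfrac ?map_poly_eq0 ?ratden_neq0//.
  rewrite -(polyOver_real_conj pR) -(polyOver_real_conj qR) -!rmorphM.
  apply/eqP; congr map_poly; apply/eqP.
  by rewrite -eq_ratfrac ?ratden_neq0// ratfrac_ratnum_ratden fE.
have dz : d.[z^*] != 0 by rewrite horner_map fmorph_eq0.
have [fz' valE] := ratvalE n dz; split; rewrite {1}E//.
by rewrite valE !horner_map -fmorph_div.
Qed.

Lemma analytic_exteriorP f :
  analytic_exterior f <-> forall z, 1 < `|z| -> ~~ ratpole f z.
Proof.
split=> H z z1; last first.
  apply: (@derivableM K K^o); first exact: derivable_poly.
  apply: (@derivableV K K^o); [exact: H|exact: derivable_poly].
have cf : {for z, continuous (fun w : K^o => ratval f w : K^o)}.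
  by apply: differentiable_continuous; apply/derivable1_diffP/H.
apply: (@bounded_ratio_nonroot _ (ratnum f) _ _ (1 + `|ratval f z|)).
- exact: coprimep_ratnum_ratden.
- exact: ratden_neq0.
- by rewrite addr_ge0.
apply: cvg_within; move/cvgrPdist_lt: cf => /(_ 1 ltr01).
apply: filterS => w; rewrite distrC => /ltW lw.
rewrite -[X in `|X|](subrK (ratval f z)).
by rewrite (le_trans (ler_normD _ _))// lerD2r.
Qed.

(** The change of variable z = 1/w.  After reversing the coefficients and
cancelling common factors, properness says that the quotient is bounded near
w = 0, so that the denominator does not vanish there either. *)
Lemma ratval_inv_disc f :
  (forall z, 1 < `|z| -> ~~ ratpole f z) -> ~~ ratpole f (-1) ->
  cvg (ratfun_at_infty f) ->
  exists p q, forall w, `|w| < 1 \/ w = -1 ->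
    q.[w] != 0 /\ (w != 0 -> ratval f w^-1 = p.[w] / q.[w]).
Proof.
move=> fan f1 fcvg.
pose n := (size (ratnum f) + size (ratden f))%N.
pose rv p := \sum_(i < n) p`_i *: 'X^(n - i) : {poly K}.
have rvE p w : (size p <= n)%N -> w != 0 -> (rv p).[w] = w ^+ n * p.[w^-1].
  move=> pn w0; rewrite /rv horner_sum (horner_coef_wide _ pn) mulr_sumr.
  apply: eq_bigr => i _; rewrite hornerZ hornerXn mulrCA; congr (_ * _).
  by rewrite exprVn -expfB// ltnW.
have numE w := @rvE (ratnum f) w (leq_addr _ _).
have denE w := @rvE (ratden f) w (leq_addl _ _).
set P := rv (ratnum f) in numE; set Q := rv (ratden f) in denE.
have Q_neq0 w : w != 0 -> `|w| < 1 \/ w = -1 -> Q.[w] != 0.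
  move=> w0 w1; rewrite denE// mulf_neq0 ?expf_neq0//.
  suff : ~~ ratpole f w^-1 by [].
  case: w1 => [w1|->]; last by rewrite invrN invr1.
  by apply: fan; rewrite normfV invf_gt1 ?normr_gt0.
have Q0 : Q != 0.
  apply: contraTneq (@Q_neq0 (-1) _ _) => [->||]; last by right.
    by rewrite horner0 eqxx.
  by rewrite oppr_eq0 oner_eq0.
have [P' [Q' [g [PE QE cop]]]] : exists P' Q' g : {poly K},
    [/\ P' * g = P, Q' * g = Q & coprimep P' Q'].
  exists (P %/ gcdp P Q), (Q %/ gcdp P Q), (gcdp P Q).
  by rewrite !divpK ?dvdp_gcdl ?dvdp_gcdr// coprimep_div_gcd// Q0 orbT.
have Q'0 : Q' != 0 by apply: contraNneq Q0 => Q'0; rewrite -QE Q'0 mul0r.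
have main w : w != 0 -> `|w| < 1 \/ w = -1 ->
    Q'.[w] != 0 /\ ratval f w^-1 = P'.[w] / Q'.[w].
  move=> w0 /(Q_neq0 _ w0) Qw; move: (Qw); rewrite -QE hornerM mulf_eq0.
  rewrite negb_or => /andP[Q'w gw]; split=> //.
  have -> : P'.[w] / Q'.[w] = P.[w] / Q.[w].
    by rewrite -PE -QE !hornerM -mulf_div divff ?mulr1.
  by rewrite numE// denE// -mulf_div divff ?mul1r// expf_neq0.
exists P', Q' => w w1; split; last by move=> w0; exact: (main w w0 w1).2.
have [w0|w0] := eqVneq w 0; last exact: (main w w0 w1).1.
rewrite {}w0 {w w1}.
apply: (@bounded_ratio_nonroot _ P' _ _ (1 + `|lim (ratfun_at_infty f) : K|)) => //.
have /cvgrPdist_lt/(_ 1 ltr01) := fcvg => fl.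
near=> w.
have w0 : (w : K) != 0 by near: w; exact: nbhs_dnbhs_neq.
have w1 : `|w| < 1 by near: w; exact: dnbhs0_lt.
have [_ <-] := main w w0 (or_introl w1).
rewrite -[X in `|X|](subrK (lim (ratfun_at_infty f) : K)).
rewrite (le_trans (ler_normD _ _))// lerD2r distrC ltW//.
by near: w.
Unshelve. all: by end_near. Qed.

End RatReal.

(** * Real coordinates of complex numbers *)

Section Coordinates.
Variable R : realType.
Local Notation C := (complexes R).
Implicit Types (w z : C) (r : R).
Local Notation Re := complex.Re.
Local Notation Im := complex.Im.

Lemma ReB w z : Re (w - z) = Re w - Re z. Proof. by case: w z => ? ? [? ?]. Qed.
Lemma ImB w z : Im (w - z) = Im w - Im z. Proof. by case: w z => ? ? [? ?]. Qed.
Lemma ReD w z : Re (w + z) = Re w + Re z. Proof. by case: w z => ? ? [? ?]. Qed.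
Lemma ImD w z : Im (w + z) = Im w + Im z. Proof. by case: w z => ? ? [? ?]. Qed.
Lemma ReMc w z : Re (w * z) = Re w * Re z - Im w * Im z.
Proof. by case: w z => ? ? [? ?]. Qed.
Lemma ImMc w z : Im (w * z) = Re w * Im z + Im w * Re z.
Proof. by case: w z => ? ? [? ?]. Qed.
Lemma Re1 : Re (1 : C) = 1. Proof. by []. Qed.
Lemma Im1 : Im (1 : C) = 0. Proof. by []. Qed.
Lemma ReR r : Re (r%:C%C : C) = r. Proof. by []. Qed.
Lemma ImR r : Im (r%:C%C : C) = 0. Proof. by []. Qed.
Lemma ReJ w : Re w^* = Re w. Proof. by case: w => ? ?. Qed.
Lemma ImJ w : Im w^* = - Im w. Proof. by case: w => ? ?. Qed.
Lemma ReN w : Re (- w) = - Re w. Proof. by case: w. Qed.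
Lemma ImN w : Im (- w) = - Im w. Proof. by case: w. Qed.
(** Rewriting with these rules turns an identity between complex numbers into
identities between real polynomials, which ring can check. *)
Definition reim := (ReB, ImB, ReD, ImD, ReMc, ImMc, Re1, Im1, ReR, ImR, ReJ, ImJ,
  ReN, ImN).

Lemma real_Complex r : (r%:C%C : C) \is Num.real.
Proof. by apply/complex_realP; exists r. Qed.

Lemma Im0_real w : Im w = 0 -> w \is Num.real.
Proof. by case: w => x y /= ->; exact: real_Complex. Qed.

(** Squared moduli are polynomials in the real coordinates, so that inequalities
between them are within reach of real arithmetic. *)
Definition sqn w : R := Re w ^+ 2 + Im w ^+ 2.

Lemma sqn_ge0 w : 0 <= sqn w.
Proof. by rewrite addr_ge0 ?sqr_ge0. Qed.

Lemma sqnM w z : sqn (w * z) = sqn w * sqn z.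
Proof. by rewrite /sqn !reim; ring. Qed.

Lemma sqn_eq0 w : (sqn w == 0) = (w == 0).
Proof. by case: w => x y; rewrite eq_complex /sqn paddr_eq0 ?sqr_ge0//= !sqrf_eq0. Qed.

Lemma sqn_gt0 w : w != 0 -> 0 < sqn w.
Proof. by move=> w0; rewrite lt_neqAle sqn_ge0 eq_sym sqn_eq0 w0. Qed.

Lemma sqnJ w : sqn w^* = sqn w.
Proof. by rewrite /sqn ReJ ImJ sqrrN. Qed.

Lemma sqnV w : sqn w^-1 = (sqn w)^-1.
Proof.
have [->|w0] := eqVneq w 0; first by rewrite invr0 /sqn /= expr0n addr0 invr0.
have s0 : sqn w != 0 by rewrite sqn_eq0.
by apply: (mulfI s0); rewrite -sqnM !divff// /sqn /= expr1n expr0n addr0.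
Qed.

Lemma sqnN1 : sqn (-1 : C) = 1.
Proof. by rewrite /sqn ReN ImN Re1 Im1 oppr0 sqrrN expr1n expr0n addr0. Qed.

Lemma sqn_Complex r : sqn (r%:C%C : C) = r ^+ 2.
Proof. by rewrite /sqn ReR ImR expr0n addr0. Qed.

Lemma sqn1 : sqn (1 : C) = 1.
Proof. by rewrite (sqn_Complex 1) expr1n. Qed.

Lemma normCE (w : C) : `|w| = (Num.sqrt (Re w ^+ 2 + Im w ^+ 2))%:C%C.
Proof. exact: normc_def. Qed.

Lemma normC_le_sqn w r : 0 <= r -> (`|w| <= r%:C%C) = (sqn w <= r ^+ 2).
Proof.
move=> r0; rewrite normCE lecR -[in LHS](ger0_norm r0) -sqrtr_sqr.
by rewrite ler_sqrt ?sqr_ge0.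
Qed.

Lemma normC_lt_sqn w r : 0 < r -> (`|w| < r%:C%C) = (sqn w < r ^+ 2).
Proof.
move=> r0; rewrite normCE ltcR -[in LHS](gtr0_norm r0) -sqrtr_sqr.
by rewrite ltr_sqrt ?exprn_gt0.
Qed.

Lemma normC_ge_Re w : `|Re w|%:C%C <= `|w|.
Proof. exact: normc_ge_Re. Qed.

Lemma normC_gt1 z : (1 < `|z|) = (1 < sqn z).
Proof.
rewrite real_ltNge ?rpred1 ?normr_real// [RHS]ltNge; congr (~~ _).
by have := normC_le_sqn z ler01; rewrite expr1n.
Qed.

Lemma normC_lt1 z : (`|z| < 1) = (sqn z < 1).
Proof. by have := normC_lt_sqn z ltr01; rewrite expr1n. Qed.

End Coordinates.

(** * The minimum principle on discs *)

Section Disc.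
Variable R : realType.
Local Notation C := (complexes R).
Implicit Types (p q : {poly C}) (a c w z : C) (x y r e : R).

Definition cplx (u : R * R) : C := Complex u.1 u.2.

Lemma normC_cplx_le (u : R * R) : `|cplx u| <= (`|u.1| + `|u.2|)%:C%C.
Proof.
rewrite normC_le_sqn ?addr_ge0// /sqn /=.
rewrite -(real_normK (num_real u.1)) -(real_normK (num_real u.2)).
by have := normr_ge0 u.1; have := normr_ge0 u.2; nra.
Qed.

Lemma continuous_cplx : continuous (cplx : R * R -> C^o).
Proof.
move=> u; apply/cvgrPdist_lt => e e0.
have eR : e = (complex.Re e)%:C%C by rewrite RRe_real// gtr0_real.
have e0' : 0 < complex.Re e by rewrite -ltcR -eR.
have e2 : 0 < complex.Re e / 2 by rewrite divr_gt0.
exists ([set x | `|u.1 - x| < complex.Re e / 2], [set x | `|u.2 - x| < complex.Re e / 2]).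
  by split; apply/nbhs_normP; exists (complex.Re e / 2).
move=> -[x y] /= [h1 h2]; rewrite eR.
have -> : cplx u - cplx (x, y) = cplx (u.1 - x, u.2 - y) by [].
apply: le_lt_trans (normC_cplx_le _) _; rewrite ltcR /=.
by rewrite [ltRHS]splitr ltrD.
Qed.

Lemma continuous_Re : continuous (@complex.Re R : C^o -> R).
Proof.
move=> w; apply/(@cvgrPdist_lt _ _ _ _ (nbhs_filter (w : C^o))) => e e0; apply/nbhs_normP.
exists e%:C%C => [|z /=]; first by rewrite /= ltcR.
have -> : complex.Re w - complex.Re z = complex.Re (w - z).
  by case: w z => [? ?] [? ?].
by move=> h; rewrite -ltcR; apply: le_lt_trans (normC_ge_Re _) h.
Qed.

(** Compactness is that of a square in R * R, from which complex numbers are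
obtained by a continuous map. *)
Lemma Re_ratio_disc_argmin c r p q : 0 <= r ->
  (forall w, sqn (w - c) <= r ^+ 2 -> q.[w] != 0) ->
  exists2 a, sqn (a - c) <= r ^+ 2 & forall w, sqn (w - c) <= r ^+ 2 ->
    complex.Re (p.[a] / q.[a]) <= complex.Re (p.[w] / q.[w]).
Proof.
move=> r0 qD; pose A : set (R * R) := [set u | sqn (cplx u - c) <= r ^+ 2].
pose f u := complex.Re (p.[cplx u] / q.[cplx u]).
have cE u : cplx (complex.Re u, complex.Im u) = u by case: u.
have cA : compact A.
  apply: (@subclosed_compact _ _ (`[complex.Re c - r, complex.Re c + r] `*`
      `[complex.Im c - r, complex.Im c + r])); last 1 first.
  - move=> [x y]; rewrite /A /= /sqn; case: (c) => a b /= H.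
    have bnd t : t ^+ 2 <= r ^+ 2 -> - r <= t <= r.
      by rewrite -ler_norml -[_ <= r]ler_sqr ?nnegrE// real_normK ?num_real.
    move: H => /=; rewrite !in_itv /= => H.
    have /bnd h1 : (x - a) ^+ 2 <= r ^+ 2 by apply: le_trans H; rewrite lerDl sqr_ge0.
    have /bnd h2 : (y - b) ^+ 2 <= r ^+ 2 by apply: le_trans H; rewrite lerDr sqr_ge0.
    by split; lra.
  - rewrite (_ : A = (fun u : R * R => (u.1 - complex.Re c) ^+ 2 +
        (u.2 - complex.Im c) ^+ 2) @^-1` [set z | z <= r ^+ 2]); last first.
      by apply/seteqP; split => -[x y]; rewrite /A /= /sqn; case: (c).
    apply: closed_comp; last exact: closed_le.
    move=> u _.
    have c1 : {for u, continuous (fun u : R * R => u.1 - complex.Re c)}.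
      by apply: cvgB; [exact: cvg_fst | exact: cvg_cst].
    have c2 : {for u, continuous (fun u : R * R => u.2 - complex.Im c)}.
      by apply: cvgB; [exact: cvg_snd | exact: cvg_cst].
    by apply: cvgD; rewrite /= !expr2; apply: cvgM.
  - by apply: compact_setX; exact: segment_compact.
have [||u /set_mem uA umin] := @compact_EVT_min _ _ f A _ cA.
- exists (complex.Re c, complex.Im c).
  by rewrite /A /= cE subrr /sqn /= expr0n addr0 sqr_ge0.
- apply: continuous_in_subspaceT => u /set_mem uA.
  apply: (@continuous_comp _ _ _ cplx (fun w : C^o => complex.Re (p.[w] / q.[w]) : R)).
    exact: continuous_cplx.
  apply: (@continuous_comp _ _ _ (fun w : C^o => p.[w] / q.[w] : C^o) (@complex.Re R)).
    exact/continuous_ratio/qD.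
  exact: continuous_Re.
exists (cplx u) => // w wD.
have := umin (complex.Re w, complex.Im w); rewrite /f cE; apply.
by rewrite inE /A /= cE.
Qed.

(** A minimum at an interior point contradicts [Re_ratio_descent] unless p / q is
constant, and then it is also attained on the boundary circle. *)
Lemma Re_ratio_disc_min_principle c r p q (b : R) : 0 < r ->
  (forall w, sqn (w - c) <= r ^+ 2 -> q.[w] != 0) ->
  (forall w, sqn (w - c) = r ^+ 2 -> b <= complex.Re (p.[w] / q.[w])) ->
  forall w, sqn (w - c) <= r ^+ 2 -> b <= complex.Re (p.[w] / q.[w]).
Proof.
move=> r0 qD bdry; have [a aD amin] := @Re_ratio_disc_argmin c r p q (ltW r0) qD.
suff ba : b <= complex.Re (p.[a] / q.[a]).
  by move=> w /amin; exact: le_trans.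
have [aI|aE] := ltrP (sqn (a - c)) (r ^+ 2); last first.
  by apply: bdry; apply/eqP; rewrite eq_le aD.
have [pE|pN] := eqVneq p ((p.[a] / q.[a]) *: q).
  move: pE; set k := _ / _ => pE.
  pose w := c + r%:C%C; have wE : sqn (w - c) = r ^+ 2.
    by rewrite /w addrAC subrr add0r /sqn /= expr0n addr0.
  apply: le_trans (bdry w wE) _; rewrite pE hornerZ mulfK//.
  by apply: qD; rewrite wE.
have e0 : 0 < r%:C%C - `|a - c| by rewrite subr_gt0 normC_lt_sqn.
have [w [wa _]] := Re_ratio_descent (qD a aD) pN e0.
rewrite -!complexRe ltcR ltNge amin//.
rewrite -normC_le_sqn ?(ltW r0)// -[w](subrK a) -addrA.
by rewrite (le_trans (ler_normD _ _))// -lerBrDr ltW.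
Qed.

End Disc.

(** * From negative imaginary to positive real *)

Section NegativeImaginary.
Variable R : realType.
Local Notation C := (complexes R).
Implicit Types (p q : {poly C}) (a c w z : C) (x y r e : R).
Local Notation Re := complex.Re.
Local Notation Im := complex.Im.

Lemma near_Re_ratio_lt0 p q a : q.[a] != 0 -> Re (p.[a] / q.[a]) < 0 ->
  exists2 e : R, 0 < e & forall w, sqn (w - a) < e ^+ 2 -> Re (p.[w] / q.[w]) < 0.
Proof.
move=> qa fa; have fa0 : 0 < (- Re (p.[a] / q.[a]))%:C%C by rewrite ltcR oppr_gt0.
have := @continuous_ratio _ p q a qa.
move=> /cvgrPdist_lt/(_ _ fa0)/nbhs_normP[e /= e0 H].
have eE : e = (Re e)%:C%C by rewrite RRe_real// gtr0_real.
have e0' : 0 < Re e by rewrite -ltcR -eE.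
exists (Re e) => // w wa; have /H : `|a - w| < e by rewrite distrC eE normC_lt_sqn.
rewrite distrC => /(le_lt_trans (normC_ge_Re _)); rewrite ltcR ReB => h.
have := le_lt_trans (ler_norm _) h; lra.
Qed.

(** With s = (1 - w)/(1 + w), the half plane Re s >= e is given by
e |1 + w|^2 <= 1 - |w|^2: a disc tangent to the unit circle at -1. *)
Lemma horodisc_identity e w : 0 < e ->
  (1 + e)^-1 ^+ 2 - sqn (w - - (e / (1 + e))%:C%C) =
  (1 - sqn w - e * sqn (1 + w)) / (1 + e).
Proof.
move=> e0; have e1 : 1 + e != 0 by rewrite gt_eqF// addr_gt0.
by rewrite opprK /sqn !reim; field.
Qed.

(** Here g = P / Q is the scalar transfer function in the coordinate w = 1/z, g0
its value at -1 and (1 + w) P1 / Q = g - g0.  As Im w and Im z have opposite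
signs, NI is the negative imaginary property of g. *)
Section NItoPR.
Variables (P Q P1 : {poly C}) (g0 : R).
Hypothesis Q0 : forall w, sqn w < 1 \/ w = -1 -> Q.[w] != 0.
Hypothesis PE : forall w, P.[w] = g0%:C%C * Q.[w] + (1 + w) * P1.[w].
Hypothesis NI : forall w, sqn w < 1 -> 0 <= Im w * Im (P.[w] / Q.[w]).

Let horo_dom e w : 0 < e -> e * sqn (1 + w) <= 1 - sqn w ->
  sqn w < 1 \/ w = -1.
Proof.
move=> e0 H; have [->|w1] := eqVneq w (-1); first by right.
left; have := sqn_gt0 (w := 1 + w); rewrite addrC addr_eq0 => /(_ w1).
by rewrite addrC => ?; nra.
Qed.

(** N e / Q is (s - e) (g - g0), where the factor 1 + w of g - g0 has cancelled
the pole of s at -1. *)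
Let N e : {poly C} := ((1 - e)%:C%C%:P - (1 + e)%:C%C *: 'X) * P1.

(** On the line Re s = e the function is i Im s (g - g0), and Im s has the sign
of - Im w. *)
Let bdry_gen e w : 0 < e -> w != -1 -> e * sqn (1 + w) = 1 - sqn w ->
  0 <= Re ((N e).[w] / Q.[w]).
Proof.
move=> e0 w1 H; have D0 : 0 < sqn (1 + w).
  by apply: sqn_gt0; rewrite addrC addr_eq0.
have wdom : sqn w < 1 by nra.
have Qw : Q.[w] != 0 by apply: Q0; left.
set h := P1.[w] / Q.[w].
have gE : P.[w] / Q.[w] = g0%:C%C + (1 + w) * h.
  by rewrite PE mulrDl mulfK// /h mulrA.
have -> : (N e).[w] / Q.[w] = ((1 - e)%:C%C - (1 + e)%:C%C * w) * h.
  by rewrite /N hornerM hornerD hornerN hornerZ hornerX hornerC /h mulrA.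
have := NI wdom; rewrite gE; clear gE; move: H D0 wdom; clearbody h.
case: (w) h => x y [u v]; rewrite /sqn !reim /= => H D0 wdom NIw.
rewrite -(pmulr_rge0 _ D0); set D := _ ^+ 2 + _ in H *.
set f := (X in D * X).
have -> : D * f = D * ((1 - x) * u + y * v) + (e * D) * (y * v - (1 + x) * u).
  by rewrite /f; ring.
rewrite H; move: NIw; rewrite /D; set k := y * _ => k0.
suff -> : D * ((1 - x) * u + y * v) +
  (1 - (x ^+ 2 + y ^+ 2)) * (y * v - (1 + x) * u) = 2 * k by rewrite mulr_ge0.
by rewrite /k /D; ring.
Qed.

(** At the point of tangency s is infinite and the previous computation does not
apply; the sign is inherited from nearby points of the circle. *)
Let bdry_infty e : 0 < e -> 0 <= Re ((N e).[-1] / Q.[-1]).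
Proof.
move=> e0; rewrite leNgt; apply/negP => neg.
have [d d0 H] := near_Re_ratio_lt0 (Q0 (or_intror erefl)) neg.
(* The point w of the circle with s = e + i t is at distance at most 2 / t
   of -1. *)
pose t := 4 / d; have t0 : 0 < t by rewrite divr_gt0.
pose k := ((1 + e) ^+ 2 + t ^+ 2)^-1.
have kt : k * ((1 + e) ^+ 2 + t ^+ 2) = 1.
  by rewrite mulVf// gt_eqF// ltr_wpDr ?sqr_ge0// exprn_gt0// addr_gt0.
have k0 : 0 < k by rewrite invr_gt0 ltr_wpDr ?sqr_ge0// exprn_gt0// addr_gt0.
pose w : C := Complex (2 * (1 + e) * k - 1) (- (2 * t * k)).
have wD1 : sqn (1 + w) = 4 * k.
  have -> : 4 * k = 4 * k * (k * ((1 + e) ^+ 2 + t ^+ 2)) by rewrite kt mulr1.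
  by rewrite /sqn /=; ring.
have w1D : sqn (w - -1) = 4 * k by rewrite opprK addrC.
have wb : e * sqn (1 + w) = 1 - sqn w.
  have -> : sqn w = sqn (1 + w) - 4 * (1 + e) * k + 1.
    by rewrite /sqn /=; ring.
  by rewrite wD1; ring.
have w1 : w != -1.
  by rewrite -subr_eq0 -sqn_eq0 w1D gt_eqF// mulr_gt0.
have := bdry_gen e0 w1 wb; rewrite leNgt => /negP; apply; apply: H.
rewrite w1D.
have td : t * d = 4 by rewrite /t divfK// gt_eqF.
have : k * t ^+ 2 <= 1 by rewrite -kt ler_pM2l// lerDr sqr_ge0.
have := exprn_gt0 2 d0 => d2 ktb.
have : k * t ^+ 2 * d ^+ 2 <= d ^+ 2 by rewrite ger_pMl.
rewrite -mulrA -exprMn td => h; lra.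
Qed.

Lemma horodisc_bound e w : 0 < e -> e * sqn (1 + w) <= 1 - sqn w ->
  0 <= Re ((N e).[w] / Q.[w]).
Proof.
move=> e0 wK; have e1 : 0 < 1 + e by rewrite addr_gt0.
have iE z : (sqn (z - - (e / (1 + e))%:C%C) <= (1 + e)^-1 ^+ 2) =
    (e * sqn (1 + z) <= 1 - sqn z).
  rewrite -subr_ge0 horodisc_identity// pmulr_lge0 ?invr_gt0//.
  by rewrite subr_ge0.
apply: (@Re_ratio_disc_min_principle _ (- (e / (1 + e))%:C%C) (1 + e)^-1); rewrite ?invr_gt0//.
- by move=> z; rewrite iE => /(horo_dom e0); exact: Q0.
- move=> z zE; have [->|z1] := eqVneq z (-1); first exact: bdry_infty.
  apply: bdry_gen => //; apply/eqP; rewrite eq_sym -subr_eq0.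
  have /eqP := horodisc_identity z e0; rewrite zE subrr eq_sym.
  by rewrite mulf_eq0 invr_eq0 (gt_eqF e1) orbF.
- by rewrite iE.
Qed.

(** Letting e tend to 0 at a fixed w: Re (s (g - g0)) >= e Re (g - g0) as soon as
e is small enough for w to lie in the disc of [horodisc_bound]. *)
Lemma disc_NI_PR w : sqn w < 1 -> 0 <= Re ((1 - w) * P1.[w] / Q.[w]).
Proof.
move=> w1; rewrite leNgt; apply/negP => neg.
set h := P1.[w] / Q.[w]; set b := Re ((1 + w) * h).
pose e := Num.min ((1 - sqn w) / (1 + sqn (1 + w)))
  (- Re ((1 - w) * P1.[w] / Q.[w]) / (1 + `|b|)).
have e0 : 0 < e.
  by rewrite lt_min !divr_gt0 ?oppr_gt0 ?subr_gt0 ?ltr_wpDr ?sqn_ge0.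
have e1 : e * (1 + sqn (1 + w)) <= 1 - sqn w.
  by rewrite -ler_pdivlMr ?ltr_wpDr ?sqn_ge0// ge_min lexx.
have e2 : e * (1 + `|b|) <= - Re ((1 - w) * P1.[w] / Q.[w]).
  by rewrite -ler_pdivlMr ?ltr_wpDr// ge_min lexx orbT.
have : 0 <= Re ((N e).[w] / Q.[w]) by apply: horodisc_bound => //; lra.
have -> : (N e).[w] / Q.[w] = (1 - w) * P1.[w] / Q.[w] - e%:C%C * ((1 + w) * h).
  rewrite /N hornerM hornerD hornerN hornerZ hornerX hornerC /h.
  by rewrite rmorphB rmorphD /=; ring.
rewrite ReB [X in _ - X]ReMc ReR ImR mul0r subr0 -/b.
have := ler_norm (- b); rewrite normrN => ?.
move=> ?; nra.
Qed.

End NItoPR.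
End NegativeImaginary.

(** * From positive real to negative imaginary *)

Section PositiveReal.
Variable R : realType.
Local Notation C := (complexes R).
Implicit Types (p q : {poly C}) (a c w z : C) (x y r e : R).
Local Notation Re := complex.Re.
Local Notation Im := complex.Im.

(** The origin stands for z = oo, where no sign is assumed. *)
Lemma Re_ge0_origin p q r : 0 < r -> q.[0] != 0 ->
  (forall w, w != 0 -> sqn w < r ^+ 2 -> 0 <= Re (p.[w] / q.[w])) ->
  0 <= Re (p.[0] / q.[0]).
Proof.
move=> r0 q0 H; rewrite leNgt; apply/negP => /(near_Re_ratio_lt0 q0)[e e0 neg].
pose d := Num.min r e / 2; have m0 : 0 < Num.min r e by rewrite lt_min r0.
have d0 : 0 < d by rewrite divr_gt0.
have [dr de] : d < r /\ d < e.
  have : Num.min r e <= r by rewrite ge_min lexx.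
  have : Num.min r e <= e by rewrite ge_min lexx orbT.
  by rewrite /d; split; lra.
have sd : sqn (d%:C%C : C) = d ^+ 2 := sqn_Complex d.
have := neg d%:C%C; rewrite subr0 sd ltr_sqr ?nnegrE ?ltW// => /(_ de).
rewrite ltNge H ?sd ?ltr_sqr ?nnegrE ?ltW//.
by rewrite -sqn_eq0 sd sqrf_eq0 gt_eqF.
Qed.

(** The Schwarz-Pick inequality on the disc of radius r at a and a^*.  The
function (f - f(a)) / (f + f(a)^* ) has modulus at most 1 because Re f > 0, and
so does its quotient by the Blaschke factor r (w - a) / (r^2 - a^* w), which has
modulus 1 on the circle.  Since f(a^* ) = f(a)^*, the bound at a^* reads
|Im f(a)| |r^2 - (a^* )^2| <= |f(a)| r |2 Im a|, and the stated form follows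
from |r^2 - (a^* )^2|^2 = (r^2 - |a|^2)^2 + 4 r^2 (Im a)^2. *)
Lemma schwarz_pick_conj p q a (r : R) :
  (forall w, sqn w < 1 -> q.[w] != 0) ->
  (forall w, sqn w < 1 -> 0 < Re (p.[w] / q.[w])) ->
  p.[a^*] / q.[a^*] = (p.[a] / q.[a])^* ->
  0 < r -> sqn a < r ^+ 2 -> r ^+ 2 < 1 -> Im a != 0 ->
  Im (p.[a] / q.[a]) ^+ 2 * (r ^+ 2 - sqn a) ^+ 2 <=
  4 * r ^+ 2 * Im a ^+ 2 * Re (p.[a] / q.[a]) ^+ 2.
Proof.
move=> q0 p_gt0 fJ r0 ar r1 ya0.
have a1 : sqn a < 1 by exact: lt_trans ar r1.
have ball1 w : sqn (w - 0) <= r ^+ 2 -> sqn w < 1.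
  by rewrite subr0 => /le_lt_trans; apply.
move: fJ (p_gt0 a a1); set fa := p.[a] / q.[a] => fJ fa0.
have [T TE] : exists T : {poly C}, forall w, p.[w] - fa * q.[w] = T.[w] * (w - a).
  have : root (p - fa *: q) a.
    by rewrite /root hornerD hornerN hornerZ /fa divfK ?subrr// q0.
  case/factor_theorem => T TE; exists T => w.
  have := congr1 (horner^~ w) TE; rewrite /= hornerD hornerN hornerZ.
  by rewrite hornerM hornerXsubC.
pose n := T * ((r ^+ 2)%:C%C%:P - a^* *: 'X).
pose d := r%:C%C *: (p + fa^* *: q).
have nE w : n.[w] = T.[w] * ((r ^+ 2)%:C%C - a^* * w).
  by rewrite /n hornerM hornerD hornerN hornerZ hornerX hornerC.
have dE w : d.[w] = r%:C%C * (p.[w] + fa^* * q.[w]).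
  by rewrite /d hornerZ hornerD hornerZ.
have fE w : sqn w < 1 -> p.[w] = p.[w] / q.[w] * q.[w] by move=> w1; rewrite divfK ?q0.
have d0 w : sqn w < 1 -> d.[w] != 0.
  move=> w1; rewrite dE (fE w w1) -mulrDl !mulf_neq0 ?q0//.
    by rewrite -sqn_eq0 sqn_Complex sqrf_eq0 gt_eqF.
  apply: contraTneq (p_gt0 w w1) => /(congr1 (@complex.Re R)).
  by rewrite ReD ReJ /= -leNgt => ?; lra.
have key w : sqn T.[w] * sqn (w - a) = sqn (p.[w] - fa * q.[w]).
  by rewrite TE sqnM.
have bdry w : sqn w = r ^+ 2 -> sqn n.[w] <= sqn d.[w].
  move=> wr; have w1 : sqn w < 1 by rewrite wr.
  have wa : w != a by apply: contraTneq ar => <-; rewrite wr ltxx.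
  have wa0 : 0 < sqn (w - a) by rewrite sqn_gt0// subr_eq0.
  rewrite -(ler_pM2r wa0) nE dE !sqnM mulrAC key.
  have -> : sqn ((r ^+ 2)%:C%C - a^* * w : C) = r ^+ 2 * sqn (w - a).
    by rewrite -wr; case: (w) (a) => ? ? [? ?]; rewrite /sqn !reim /=; ring.
  rewrite sqn_Complex [leRHS]mulrAC [leRHS]mulrC ler_pM2r; last first.
    by rewrite mulr_gt0// exprn_gt0.
  rewrite {1}(fE w w1) [p.[w] in X in _ <= X](fE w w1) -mulrBl -mulrDl !sqnM.
  apply: ler_wpM2r (sqn_ge0 _) _ _ _; have := p_gt0 w w1; move: fa0.
  case: (fa) (p.[w] / q.[w]) => u v [u' v']; rewrite /sqn !reim /= => *; nra.
(* The modulus is bounded through real parts: on the circle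
   Re (k phi) <= (|k|^2 + 1) / 2, and at w the choice k = phi(w)^* turns this
   into |phi(w)|^2 <= 1, where phi = n / d. *)
have inner w : sqn w <= r ^+ 2 -> sqn (n.[w] / d.[w]) <= 1.
  move=> wr; set k := (n.[w] / d.[w])^*.
  have := @Re_ratio_disc_min_principle _ 0 r (- k *: n) d (- ((sqn k + 1) / 2)) r0.
  have bw : sqn (w - 0) <= r ^+ 2 by rewrite subr0.
  move=> /(_ _ _ w bw); rewrite hornerZ -mulrA => H.
  have {H} : - ((sqn k + 1) / 2) <= Re (- k * (n.[w] / d.[w])).
    apply: H => z zr; first exact/d0/ball1.
    rewrite subr0 in zr; rewrite hornerZ -mulrA mulNr ReN.
    have z1 : sqn z < 1 by rewrite zr.
    have : sqn (n.[z] / d.[z]) <= 1.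
      by rewrite sqnM sqnV ler_pdivrMr ?mul1r ?bdry// sqn_gt0// d0.
    case: (k) (n.[z] / d.[z]) => u v [u' v']; rewrite /sqn !reim /= => ?.
    have := sqr_ge0 (u - u'); have := sqr_ge0 (v + v'); lra.
  rewrite /k mulNr ReN sqnJ; case: (n.[w] / d.[w]) => u v; rewrite /sqn !reim /= => ?; nra.
have aJr : sqn a^* <= r ^+ 2 by rewrite sqnJ ltW.
have aJ1 : sqn a^* < 1 by rewrite sqnJ.
have := inner _ aJr; rewrite sqnM sqnV ler_pdivrMr ?sqn_gt0 ?d0// mul1r.
have aa0 : 0 < sqn (a^* - a).
  have -> : sqn (a^* - a) = 4 * Im a ^+ 2 by rewrite /sqn !reim; ring.
  by rewrite mulr_gt0// exprn_even_gt0.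
rewrite -(ler_pM2r aa0) nE dE !sqnM mulrAC key.
rewrite (fE _ aJ1) -mulrBl -mulrDl !sqnM fJ.
have qa : 0 < sqn q.[a^*] by rewrite sqn_gt0// q0.
have -> : sqn (fa^* - fa) = 4 * Im fa ^+ 2 by rewrite /sqn !reim; ring.
have -> : sqn (fa^* + fa^*) = 4 * (Re fa ^+ 2 + Im fa ^+ 2).
  by rewrite /sqn !reim; ring.
have -> : sqn (a^* - a) = 4 * Im a ^+ 2 by rewrite /sqn !reim; ring.
rewrite sqn_Complex.
have -> : sqn ((r ^+ 2)%:C%C - a^* * a^* : C) =
    (r ^+ 2 - sqn a) ^+ 2 + 4 * r ^+ 2 * Im a ^+ 2.
  by rewrite /sqn !reim; ring.
by move=> H; rewrite -(ler_pM2l qa); lra.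
Qed.

(** The limit r -> 1 of [schwarz_pick_conj], applied to f + dl with dl > 0 since
Re f is only assumed nonnegative.  With s = (1 - a)/(1 + a), the factors
1 - |a|^2 and 2 |Im a| are |1 + a|^2 times Re s and |Im s|. *)
Lemma disc_PR_NI p q a :
  (forall w, sqn w < 1 -> q.[w] != 0) ->
  (forall w, w != 0 -> sqn w < 1 -> 0 <= Re (p.[w] / q.[w])) ->
  p.[a^*] / q.[a^*] = (p.[a] / q.[a])^* ->
  sqn a < 1 -> Im a != 0 ->
  `|Im (p.[a] / q.[a])| * (1 - sqn a) <= 2 * `|Im a| * Re (p.[a] / q.[a]).
Proof.
move=> q0 p_ge0 fJ a1 ya0; have aJ1 : sqn a^* < 1 by rewrite sqnJ.
have {}p_ge0 w : sqn w < 1 -> 0 <= Re (p.[w] / q.[w]).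
  have [->|w0] := eqVneq w 0; last exact: p_ge0.
  move=> w1; apply: (@Re_ge0_origin _ _ 1) => //; first exact: q0.
  by move=> z z0; rewrite expr1n; exact: p_ge0.
set f := p.[a] / q.[a] in fJ *.
have sa0 := sqn_ge0 a.
suff main dl rho : 0 < dl -> sqn a < rho -> rho < 1 ->
    `|Im f| * (rho - sqn a) <= 2 * `|Im a| * (Re f + dl).
  rewrite leNgt; apply/negP => H.
  have A0 : 0 <= `|Im f| by []. have Y0 : 0 <= `|Im a| by [].
  move: H A0 Y0 main; set A := `|Im f|; set Y := `|Im a| => H A0 Y0 main.
  pose g := A * (1 - sqn a) - 2 * Y * Re f; have g0 : 0 < g by rewrite subr_gt0.
  pose eta := Num.min ((1 - sqn a) / 2) (g / (4 * (A + 1))).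
  have A1 : 0 < 4 * (A + 1) by lra. have Y1 : 0 < 4 * (2 * Y + 1) by lra.
  have eta0 : 0 < eta by rewrite lt_min !divr_gt0// subr_gt0.
  have eta1 : eta <= (1 - sqn a) / 2 by rewrite ge_min lexx.
  have eta2 : eta * (4 * (A + 1)) <= g by rewrite -ler_pdivlMr// ge_min lexx orbT.
  pose dl := g / (4 * (2 * Y + 1)); have dl0 : 0 < dl by rewrite divr_gt0.
  have dlE : dl * (4 * (2 * Y + 1)) = g by rewrite divfK// gt_eqF.
  have := main dl (1 - eta) dl0; rewrite /g in g0 eta2 dlE.
  by move=> /(_ ltac:(lra) ltac:(lra)) ?; nra.
move=> dl0 ar r1; have rho0 : 0 < rho by exact: le_lt_trans ar.
pose r := Num.sqrt rho; have r0 : 0 < r by rewrite sqrtr_gt0.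
have rE : r ^+ 2 = rho by rewrite sqr_sqrtr// ltW.
pose p' := p + dl%:C%C *: q.
have pE w : sqn w < 1 -> p'.[w] / q.[w] = p.[w] / q.[w] + dl%:C%C.
  by move=> w1; rewrite /p' hornerD hornerZ mulrDl mulfK// q0.
have p'0 w : sqn w < 1 -> 0 < Re (p'.[w] / q.[w]).
  by move=> w1; rewrite pE// ReD ReR ltr_wpDl// p_ge0.
have f'J : p'.[a^*] / q.[a^*] = (p'.[a] / q.[a])^*.
  rewrite !pE// fJ rmorphD /=; congr (_ + _).
  by rewrite conj_Creal// real_Complex.
have := schwarz_pick_conj q0 p'0 f'J r0; rewrite rE => /(_ ar r1 ya0).
rewrite pE// -/f ImD ImR ReD ReR addr0 => H.
have f0 : 0 <= Re f by exact: p_ge0.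
have b1 : 0 <= `|Im f| * (rho - sqn a) by rewrite mulr_ge0// subr_ge0 ltW.
have b2 : 0 <= 2 * `|Im a| * (Re f + dl).
  by rewrite !mulr_ge0// addr_ge0// ltW.
rewrite -ler_sqr ?nnegrE// !exprMn !real_normK ?num_real//.
apply: le_trans H _.
have : 0 <= (2 ^+ 2 * Im a ^+ 2 * (Re f + dl) ^+ 2) * (1 - rho).
  by rewrite -!exprMn mulr_ge0 ?sqr_ge0 ?subr_ge0 ?ltW.
lra.
Qed.

End PositiveReal.

(** * The scalar equivalence outside the unit disc *)

Section Exterior.
Variable R : realType.
Local Notation C := (complexes R).
Implicit Types (p q : {poly C}) (a c w z : C) (x y r e : R) (g : C -> C).
Local Notation Re := complex.Re.
Local Notation Im := complex.Im.

(** Regularity of g outside the closed unit disc, at -1 and at infinity, in the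
coordinate w = 1/z; the value at w = 0 is left free because g is only evaluated
at finite points. *)
Definition disc_ratio g := exists p q, forall w, sqn w < 1 \/ w = -1 ->
  q.[w] != 0 /\ (w != 0 -> g w^-1 = p.[w] / q.[w]).

Lemma disc_ratio_cst c : disc_ratio (fun=> c).
Proof.
by exists c%:P, 1 => w _; rewrite !hornerE oner_eq0 divr1.
Qed.

Lemma disc_ratioD g1 g2 : disc_ratio g1 -> disc_ratio g2 ->
  disc_ratio (fun z => g1 z + g2 z).
Proof.
move=> [p1 [q1 H1]] [p2 [q2 H2]]; exists (p1 * q2 + p2 * q1), (q1 * q2) => w wD.
have [q1w E1] := H1 w wD; have [q2w E2] := H2 w wD.
rewrite hornerM mulf_neq0//; split=> // w0.
by rewrite E1// E2// addf_div// hornerD !hornerM.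
Qed.

Lemma disc_ratioZ c g : disc_ratio g -> disc_ratio (fun z => c * g z).
Proof.
move=> [p [q H]]; exists (c *: p), q => w wD; have [qw E] := H w wD.
by split=> // w0; rewrite E// hornerZ mulrA.
Qed.

Lemma disc_ratio_sum (I : Type) (s : seq I) (g : I -> C -> C) :
  (forall i, disc_ratio (g i)) -> disc_ratio (fun z => \sum_(i <- s) g i z).
Proof.
move=> H; elim: s => [|i s IH].
  by under eq_fun do rewrite big_nil; exact: disc_ratio_cst.
by under eq_fun do rewrite big_cons; exact: disc_ratioD.
Qed.

(** The numerator of g - g(-1) vanishes at w = -1, which yields h. *)
Lemma disc_ratioP g : disc_ratio g -> exists p q h,
  [/\ forall w, sqn w < 1 \/ w = -1 -> q.[w] != 0,
      forall w, sqn w < 1 \/ w = -1 -> w != 0 -> g w^-1 = p.[w] / q.[w] &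
      forall w, p.[w] = g (-1) * q.[w] + (1 + w) * h.[w]].
Proof.
move=> [p [q H]]; have [q1 E] := H (-1) (or_intror erefl).
have /factor_theorem[h hE] : root (p - g (-1) *: q) (-1).
  rewrite /root hornerD hornerN hornerZ -[X in g X]invrK invrN invr1 E.
    by rewrite divfK ?subrr.
  by rewrite oppr_eq0 oner_eq0.
exists p, q, h; split=> [w /H[]//|w /H[]//|w].
have := congr1 (horner^~ w) hE; rewrite /= hornerD hornerN hornerZ.
rewrite hornerM hornerXsubC opprK => /eqP; rewrite subr_eq => /eqP ->.
by rewrite addrC [h.[w] * _]mulrC [w + 1]addrC.
Qed.

Lemma sqnV_lt1 z : 1 < sqn z -> [/\ z != 0, sqn z^-1 < 1 & Im z^-1 = - Im z / sqn z].
Proof.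
move=> z1; have z0 : z != 0 by rewrite -sqn_eq0 gt_eqF// (lt_trans _ z1).
split=> //; first by rewrite sqnV invf_lt1// sqn_gt0.
by case: (z) => x y; rewrite mulNr.
Qed.

Definition cayley z := (z - 1) / (z + 1).

Lemma cayleyV w : w != 0 -> w != -1 -> cayley w^-1 = (1 - w) / (1 + w).
Proof.
move=> w0; rewrite -addr_eq0 => w1.
by rewrite /cayley; field; rewrite w0 addrC w1.
Qed.

Lemma exterior_NI_PR g : disc_ratio g -> Im (g (-1)) = 0 ->
  (forall z, 1 < sqn z -> Im z * Im (g z) <= 0) ->
  forall z, 1 < sqn z -> 0 <= Re (cayley z * (g z - g (-1))).
Proof.
move=> /disc_ratioP[p [q [h [q0 gE pE]]]] g0 NI z z1.
have gR : g (-1) = (Re (g (-1)))%:C%C.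
  by case: (g (-1)) g0 => x y /= ->.
have [z0 w1 _] := sqnV_lt1 z1.
pose w := z^-1; have w0 : w != 0 by rewrite invr_eq0.
have wN1 : w != -1.
  by apply: contraTneq w1; rewrite -/w => ->; rewrite sqnN1 ltxx.
have := @disc_NI_PR _ p q h (Re (g (-1))) q0 _ _ w w1.
rewrite -gR => /(_ pE) H.
have -> : cayley z * (g z - g (-1)) = (1 - w) * h.[w] / q.[w].
  have qw : q.[w] != 0 by apply: q0; left.
  rewrite -[z]invrK -/w cayleyV// gE//; last by left.
  rewrite pE; field.
  by rewrite qw addrC addr_eq0 wN1.
apply: H => w' w'1; have [->|w'0] := eqVneq w' 0; first by rewrite mul0r.
rewrite -gE//; last by left.
have s0 := sqn_gt0 w'0.
have w'V : 1 < sqn w'^-1 by rewrite sqnV invf_gt1.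
have := NI _ w'V; have [_ _] := sqnV_lt1 w'V; rewrite invrK => ->.
move=> K; rewrite mulrAC !mulNr oppr_ge0.
by rewrite pmulr_lle0// invr_gt0 (lt_trans _ w'V).
Qed.

Lemma exterior_PR_NI g : disc_ratio g -> Im (g (-1)) = 0 ->
  (forall z, 1 < sqn z -> g z^* = (g z)^*) ->
  (forall z, 1 < sqn z -> 0 <= Re (cayley z * (g z - g (-1)))) ->
  forall z, 1 < sqn z -> Im z * Im (g z) <= 0.
Proof.
move=> /disc_ratioP[p [q [h [q0 gE pE]]]] g0 gJ PR z z1.
have [y0|y0] := eqVneq (Im z) 0; first by rewrite y0 mul0r.
have [z0 a1 aI] := sqnV_lt1 z1.
have fE w : w != 0 -> sqn w < 1 ->
    cayley w^-1 * (g w^-1 - g (-1)) = ((1 - 'X) * h).[w] / q.[w].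
  move=> w0 w1; have wN1 : w != -1.
    by apply: contraTneq w1 => ->; rewrite sqnN1 ltxx.
  have qw : q.[w] != 0 by apply: q0; left.
  rewrite hornerM hornerD hornerN hornerX hornerC cayleyV// gE//; last by left.
  by rewrite pE; field; rewrite qw addrC addr_eq0 wN1.
have inv_ext w : w != 0 -> sqn w < 1 -> 1 < sqn w^-1.
  by move=> w0 w1; rewrite sqnV invf_gt1 ?sqn_gt0.
pose a := z^-1; have a0 : a != 0 by rewrite invr_eq0.
have aJ0 : a^* != 0 by rewrite conjC_eq0.
have aJ1 : sqn a^* < 1 by rewrite sqnJ.
have g0J : (g (-1))^* = g (-1) by apply/conj_Creal/Im0_real.
have ya : Im a != 0.
  by rewrite aI mulf_neq0 ?oppr_eq0// invr_eq0 gt_eqF// (lt_trans _ z1).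
have := @disc_PR_NI _ ((1 - 'X) * h) q a _ _ _ a1 ya.
have fJ : ((1 - 'X) * h).[a^*] / q.[a^*] = (((1 - 'X) * h).[a] / q.[a])^*.
  rewrite -!fE// [a^-1]invrK.
  have -> : (a^*)^-1 = z^* by rewrite -fmorphV invrK.
  rewrite gJ// rmorphM rmorphB /= g0J; congr (_ * _).
  by rewrite /cayley fmorph_div rmorphB rmorphD /= rmorph1.
move=> /(_ _ _ fJ) H.
have {H} : `|Im (((1 - 'X) * h).[a] / q.[a])| * (1 - sqn a) <=
    2 * `|Im a| * Re (((1 - 'X) * h).[a] / q.[a]).
  apply: H => w; first by move=> w1; apply: q0; left.
  by move=> w0 w1; rewrite -fE//; apply/PR/inv_ext.
rewrite -fE// [a^-1]invrK.
set f := cayley z * _ => H.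
have aN1 : 1 + a != 0.
  by rewrite addrC addr_eq0; apply: contraTneq a1; rewrite -/a => ->; rewrite sqnN1 ltxx.
have a_neq1 : 1 - a != 0.
  rewrite subr_eq0 eq_sym; apply: contraTneq a1; rewrite -/a => ->.
  by rewrite sqn1 ltxx.
(* Clearing denominators in g - g (-1) = f / s, where 1 / s is
   (1 + a) (1 - a^* ) / |1 - a|^2. *)
have gE2 : g z * (sqn (1 - a))%:C%C =
    g (-1) * (sqn (1 - a))%:C%C + f * ((1 + a) * (1 - a^*)).
  have -> : (sqn (1 - a))%:C%C = (1 - a) * (1 - a^*) :> C.
    by apply/eqP; rewrite eq_complex /sqn !reim; apply/andP; split; apply/eqP; ring.
  rewrite /f -{2}[z]invrK -/a cayleyV//; last by rewrite -addr_eq0 addrC.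
  by field.
have {gE2} := congr1 (@complex.Im R) gE2; rewrite [in LHS]ImMc ReR ImR mulr0 add0r.
rewrite ImD [Im (g (-1) * _)]ImMc ReR ImR g0 mulr0 mul0r addr0 add0r => gE2.
have S0 := sqn_gt0 a_neq1; have z0' : 0 < sqn z by rewrite sqn_gt0.
suff : 0 <= Im a * Im (g z).
  by rewrite /a aI mulrAC mulNr mulNr oppr_ge0 pmulr_lle0// invr_gt0.
rewrite -(pmulr_lge0 _ S0) -mulrA gE2; move: H; rewrite ImMc.
set u := Re f; set v := Im f; rewrite /sqn !reim; set x := Re a; set y := Im a.
move=> H; have -> : (u * ((1 + x) * (0 - - y) + (0 + y) * (1 - x)) +
   v * ((1 + x) * (1 - x) - (0 + y) * (0 - - y))) = 2 * u * y + v * (1 - (x ^+ 2 + y ^+ 2)).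
  by ring.
have := mulr_ge0 (normr_ge0 y) (_ : 0 <= 2 * `|y| * u - `|v| * (1 - (x ^+ 2 + y ^+ 2))).
rewrite subr_ge0 => /(_ H); rewrite mulrBr.
have -> : `|y| * (2 * `|y| * u) = 2 * u * y ^+ 2.
  by rewrite -[y ^+ 2]real_normK ?num_real//; ring.
have := ler_norm (- (y * v)); rewrite normrN normrM => yv.
have : 0 <= 1 - (x ^+ 2 + y ^+ 2) by rewrite subr_ge0 ltW.
nra.
Qed.

End Exterior.

(** * Real symmetric matrices and their quadratic forms *)

Lemma sym_mx_swap (T : Type) (n : nat) (M : 'M[T]_n) i j :
  M^T = M -> M j i = M i j.
Proof. by move=> Msym; rewrite -[in LHS]Msym mxE. Qed.

Section Forms.
Variables (R : realType) (m : nat).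
Local Notation C := (complexes R).
Implicit Types (M N : 'M[C]_m) (u : 'I_m -> R).
Local Notation Re := complex.Re.
Local Notation Im := complex.Im.

Definition rform u M : C := \sum_i \sum_j (u i * u j)%:C%C * M i j.

Lemma sesq_sum (v : 'cV[C]_m) N :
  (v ^t* *m N *m v) 0 0 = \sum_i \sum_j (v i 0)^* * v j 0 * N i j.
Proof.
rewrite mxE exchange_big /=; apply: eq_bigr => j _.
rewrite mxE mulr_suml; apply: eq_bigr => i _.
by rewrite !mxE mulrAC.
Qed.

(** For v = a + i b and N real symmetric, v^* N v = a^T N a + b^T N b: the cross
terms cancel. *)
Lemma psdmx_real_symP N : N \is a realmx -> N^T = N ->
  psdmx N <-> forall u, 0 <= rform u N.
Proof.
move=> Nreal Nsym; split=> [[_ Npsd] u|Nu].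
  have := Npsd (\col_i (u i)%:C%C); rewrite sesq_sum => /le_trans; apply.
  rewrite le_eqVlt; apply/orP; left; apply/eqP.
  apply: eq_bigr => i _; apply: eq_bigr => j _; rewrite !mxE rmorphM.
  by rewrite conj_Creal//; exact: real_Complex.
split.
  by apply: realsym_hermsym => //; apply/is_hermitianmxP; rewrite scale1r map_mx_id// Nsym.
move=> v; rewrite sesq_sum.
have -> : \sum_i \sum_j (v i 0)^* * v j 0 * N i j =
    rform (fun i => Re (v i 0)) N + rform (fun i => Im (v i 0)) N; last by rewrite addr_ge0.
(* Twice the sum, symmetrised in i and j, has termwise equal summands. *)
apply: (@mulfI _ 2); first by rewrite pnatr_eq0.
rewrite mulr_natl mulr2n {2}exchange_big /= -!big_split mulr_sumr /=.
apply: eq_bigr => i _; rewrite -!big_split mulr_sumr /=.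
apply: eq_bigr => j _.
rewrite (sym_mx_swap i j Nsym).
rewrite -!mulrDl mulrA; congr (_ * _).
by case: (v i 0) (v j 0) => a b [c d]; apply/eqP; rewrite eq_complex /=;
  apply/andP; split; apply/eqP; ring.
Qed.

Lemma rformD u M N : rform u (M + N) = rform u M + rform u N.
Proof.
rewrite -big_split; apply: eq_bigr => i _; rewrite -big_split.
by apply: eq_bigr => j _; rewrite mxE mulrDr.
Qed.

Lemma rformZ u (c : C) M : rform u (c *: M) = c * rform u M.
Proof.
rewrite mulr_sumr; apply: eq_bigr => i _; rewrite mulr_sumr.
by apply: eq_bigr => j _; rewrite mxE mulrCA.
Qed.

Lemma rform_conj u M : M^T = M -> rform u (M ^t*) = (rform u M)^*.
Proof.
move=> Msym; rewrite rmorph_sum; apply: eq_bigr => i _; rewrite rmorph_sum.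
apply: eq_bigr => j _; rewrite Msym mxE [RHS]rmorphM; congr (_ * _).
by rewrite [RHS]conj_Creal// real_Complex.
Qed.

Lemma Im_mx_real M : M^T = M -> 'i *: (M - M ^t*) \is a realmx.
Proof.
move=> Msym; apply/mxOverP => i j; rewrite Msym !mxE; apply/CrealP.
by rewrite rmorphM rmorphB /= conjCi conjCK mulNr -mulrN opprB.
Qed.

Lemma psdmx_Im_leP M : M^T = M ->
  psdmx ('i *: (M - M ^t*)) <-> forall u, Im (rform u M) <= 0.
Proof.
move=> Msym; rewrite psdmx_real_symP ?Im_mx_real//; last first.
  by apply/matrixP => i j; rewrite !mxE (sym_mx_swap i j Msym).
have E u : (0 <= rform u ('i *: (M - M ^t*))) = (Im (rform u M) <= 0).
  rewrite rformZ rformD -scaleN1r rformZ rform_conj// mulN1r.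
  have -> : 'i * (rform u M - (rform u M)^*) = - (2 * (Im (rform u M))%:C%C).
    rewrite (subcJ (rform u M)) mulrCA.
    have -> : 'i * 'i%C = -1 :> C by rewrite complexiE; exact: sqrCi.
    by rewrite mulrN1.
  by rewrite oppr_ge0 pmulr_rle0 ?ltr0n// lecR.
by split=> H u; move: (H u); rewrite E.
Qed.

Lemma nsdmx_Im_geP M : M^T = M ->
  nsdmx ('i *: (M - M ^t*)) <-> forall u, 0 <= Im (rform u M).
Proof.
move=> Msym; have MNsym : (- M)^T = - M by rewrite linearN /= Msym.
rewrite /nsdmx; have -> : - ('i *: (M - M ^t*)) = 'i *: (- M - (- M) ^t*).
  by apply/matrixP => i j; rewrite !mxE rmorphN -opprD mulrN.
rewrite psdmx_Im_leP//; have E u : Im (rform u (- M)) = - Im (rform u M).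
  by rewrite -scaleN1r rformZ mulN1r ImN.
by split=> H u; move: (H u); rewrite E oppr_le0.
Qed.

Lemma psdmx_Re_geP M : M^T = M ->
  psdmx (M ^t* + M) <-> forall u, 0 <= Re (rform u M).
Proof.
move=> Msym; rewrite psdmx_real_symP; last first.
- by apply/matrixP => i j; rewrite !mxE (sym_mx_swap i j Msym).
- apply/mxOverP => i j; rewrite Msym !mxE; apply/CrealP.
  by rewrite rmorphD /= conjCK addrC.
have E u : (0 <= rform u (M ^t* + M)) = (0 <= Re (rform u M)).
  by rewrite rformD rform_conj// addrC (addcJ (rform u M)) pmulr_rge0 ?ltr0n// lecR.
by split=> H u; move: (H u); rewrite E.
Qed.

End Forms.

(** * The transfer function F *)

Section Entries.
Variable R : realType.
Local Notation C := (complexes R).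
Implicit Types (f : ratfun C) (z c : C).

Definition shifted_entry f c : ratfun C :=
  ratfrac ('X - 1) ('X + 1) * (f - ratconst c).

Lemma XaddC1_neq0 : 'X + 1 != 0 :> {poly C}.
Proof. by have := polyXsubC_eq0 (-1 : C); rewrite polyCN opprK => ->. Qed.

Lemma XsubC1_neq0 : 'X - 1 != 0 :> {poly C}.
Proof. by rewrite (polyXsubC_eq0 (1 : C)). Qed.

Lemma ratval_cayley z : z != -1 ->
  ~~ ratpole (ratfrac ('X - 1) ('X + 1)) z /\
  ratval (ratfrac ('X - 1) ('X + 1)) z = cayley z.
Proof.
move=> z1; have [|s1 ->] := @ratvalE _ ('X - 1) ('X + 1) z.
  by rewrite hornerD hornerX hornerC addr_eq0.
by split=> //; rewrite !(hornerD, hornerN, hornerX, hornerC).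
Qed.

Lemma ratval_shifted f c z : z != -1 -> ~~ ratpole f z ->
  ~~ ratpole (shifted_entry f c) z /\
  ratval (shifted_entry f c) z = cayley z * (ratval f z - c).
Proof.
move=> z1 fz; have [s1 s2] := ratval_cayley z1.
have cE : - ratconst c = ratconst (- c).
  by rewrite /ratconst polyCN tofracN.
have [c1 c2] := ratval_const (- c) z.
have [d1 d2] := ratvalD fz c1.
have [e1 e2] := ratvalM s1 d1.
by rewrite /shifted_entry cE e2 s2 d2 c2.
Qed.

(** Multiplication by (z - 1)/(z + 1) can be undone where z is not 1. *)
Lemma nonpole_shifted f c z : z != 1 -> ~~ ratpole (shifted_entry f c) z ->
  ~~ ratpole f z.
Proof.
move=> z1 Fz.
have -> : f = ratfrac ('X + 1) ('X - 1) * shifted_entry f c + ratconst c.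
  rewrite /shifted_entry mulrA /ratfrac mulf_div [X in X / _]mulrC divff ?mul1r ?subrK//.
  by rewrite mulf_neq0// tofrac_eq0 ?XaddC1_neq0 ?XsubC1_neq0.
have [|s1 _] := @ratvalE _ ('X + 1) ('X - 1) z.
  by rewrite !(hornerD, hornerN, hornerX, hornerC) subr_eq0.
have [d1 _] := ratvalM s1 Fz.
by have [] := ratvalD d1 (ratval_const c z).1.
Qed.

Lemma conj_polyOver_real (p : {poly C}) :
  map_poly Num.conj p = p -> p \is a polyOver Num.real.
Proof.
move=> pE; apply/polyOverP => i; apply/CrealP.
by rewrite -{2}pE coef_map.
Qed.

Lemma ratreal_shifted f c : ratreal f -> c \is Num.real ->
  ratreal (shifted_entry f c).
Proof.
move=> [p [q [pR qR q0 ->]]] cR.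
exists (('X - 1) * (p - c *: q)), (('X + 1) * q); split.
- apply/conj_polyOver_real.
  rewrite rmorphM !rmorphB /= map_polyX rmorph1 map_polyZ /=.
  by rewrite !polyOver_real_conj// conj_Creal.
- apply/conj_polyOver_real.
  by rewrite rmorphM rmorphD /= map_polyX rmorph1 polyOver_real_conj.
- by rewrite mulf_neq0// XaddC1_neq0.
rewrite /shifted_entry; have -> : ratfrac p q - ratconst c = ratfrac (p - c *: q) q.
  rewrite /ratfrac /ratconst tofracB mulrBl -mul_polyC tofracM mulfK//.
  by rewrite tofrac_eq0.
by rewrite /ratfrac mulf_div -!tofracM.
Qed.

End Entries.

Section TransferFunction.
Variables (R : realType) (m : nat) (G : ratmx (complexes R) m).
Hypotheses (Gsym : mxsymmetric G) (Greal : mxreal G) (Gproper : mxproper G)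
  (Gpole : ~~ mxpole G (-1)).
Local Notation C := (complexes R).
Implicit Types (z w : C) (u : 'I_m -> R).
Local Notation Re := complex.Re.
Local Notation Im := complex.Im.
Local Notation F := (ratfrac ('X - 1) ('X + 1) *:
  (G - map_mx (@ratconst _) (mxval G (-1)))).

Lemma shiftedE i j : F i j = shifted_entry (G i j) (ratval (G i j) (-1)).
Proof. by rewrite !mxE. Qed.

Lemma G_regular_N1 i j : ~~ ratpole (G i j) (-1).
Proof.
by apply: contra Gpole => p; apply/existsP; exists i; apply/existsP; exists j.
Qed.

Lemma mxval_sym z : (mxval G z)^T = mxval G z.
Proof. by apply/matrixP => i j; rewrite !mxE {1}Gsym mxE. Qed.

Lemma mxval_infty_sym : mxval_infty G = (mxval_infty G)^T.
Proof. by apply/matrixP => i j; rewrite !mxE {1}Gsym mxE. Qed.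

Lemma sqn_gt1_neq z : 1 < sqn z -> z != 1 /\ z != -1.
Proof.
by move=> z1; split; apply: contraTneq z1 => ->;
  rewrite ?sqnN1 ?sqn1 ltxx.
Qed.

Lemma mxanalytic_shifted : mxanalytic F <-> mxanalytic G.
Proof.
split=> H i j; apply/analytic_exteriorP => z z1;
  have /analytic_exteriorP/(_ z z1) := H i j; move: z1; rewrite shiftedE normC_gt1.
  by move=> /sqn_gt1_neq[z1 _]; exact: nonpole_shifted.
by move=> /sqn_gt1_neq[_ z1] Gz; exact: (ratval_shifted _ z1 Gz).1.
Qed.

Lemma mxval_real_N1 i j : ratval (G i j) (-1) \is Num.real.
Proof.
apply/CrealP; have [_ <-] := ratval_conj (Greal i j) (G_regular_N1 i j).
by rewrite rmorphN rmorph1.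
Qed.

Section Analytic.
Hypothesis Gan : mxanalytic G.

Lemma G_regular i j z : 1 < sqn z -> ~~ ratpole (G i j) z.
Proof.
by rewrite -normC_gt1 => z1; have /analytic_exteriorP/(_ z z1) := @Gan i j.
Qed.

Lemma mxval_shifted z : 1 < sqn z -> mxval F z = cayley z *: (mxval G z - mxval G (-1)).
Proof.
move=> z1; have [_ zN1] := sqn_gt1_neq z1; apply/matrixP => i j.
transitivity (ratval (F i j) z); first by rewrite mxE.
by rewrite shiftedE (ratval_shifted _ zN1 (G_regular i j z1)).2 !mxE.
Qed.

Lemma mxval_shifted_sym z : 1 < sqn z -> (mxval F z)^T = mxval F z.
Proof. by move=> z1; rewrite mxval_shifted// linearZ linearB /= !mxval_sym. Qed.

Lemma rform_shifted u z : 1 < sqn z ->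
  rform u (mxval F z) = cayley z * (rform u (mxval G z) - rform u (mxval G (-1))).
Proof.
by move=> z1; rewrite mxval_shifted// rformZ rformD -scaleN1r rformZ mulN1r.
Qed.

Lemma rform_disc_ratio u : disc_ratio (fun z => rform u (mxval G z)).
Proof.
apply: disc_ratio_sum => i; apply: disc_ratio_sum => j; apply: disc_ratioZ.
have [|p [q H]] := @ratval_inv_disc _ (G i j) _ (G_regular_N1 i j) (@Gproper i j).
  by apply/analytic_exteriorP; exact: Gan.
exists p, q => w wD; rewrite mxE; apply: H.
by rewrite normC_lt1.
Qed.

Lemma rform_mxval_conj u z : 1 < sqn z ->
  rform u (mxval G z^*) = (rform u (mxval G z))^*.
Proof.
move=> z1; rewrite -rform_conj ?mxval_sym//; congr rform.
apply/matrixP => i j; rewrite !mxE.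
exact: (ratval_conj (Greal i j) (G_regular i j z1)).2.
Qed.

Lemma rform_N1_real u : Im (rform u (mxval G (-1))) = 0.
Proof.
suff : rform u (mxval G (-1)) \is Num.real by move/RIm_real => [].
apply: rpred_sum => i _; apply: rpred_sum => j _; rewrite mxE.
by rewrite rpredM ?mxval_real_N1// real_Complex.
Qed.

(** The three cases of the definition, according to the sign of Im z, merge into
one sign condition; on the real axis G(z) is real by conjugation symmetry. *)
Lemma DNI_rformP : DNI G <->
  forall u z, 1 < sqn z -> Im z * Im (rform u (mxval G z)) <= 0.
Proof.
split=> [[_ _ H] u z z1|H].
  have := H z; rewrite normC_gt1 => /(_ z1)[].
  rewrite -!complexIm !ltcR => Hp _ Hn.
  have [y0|y0|->] := ltrgtP (Im z) 0; last by rewrite mul0r.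
    by have /nsdmx_Im_geP -/(_ (mxval_sym z) u) := Hn y0; nra.
  by have /psdmx_Im_leP -/(_ (mxval_sym z) u) := Hp y0; nra.
split=> // z; rewrite normC_gt1 => z1; rewrite -!complexIm; split.
- rewrite ltcR => y0; apply/psdmx_Im_leP => [|u]; first exact: mxval_sym.
  by have := H u z z1; rewrite pmulr_rle0.
- move=> [y0]; apply/matrixP => i j; rewrite !mxE (sym_mx_swap i j (esym Gsym)).
  rewrite -(ratval_conj (Greal i j) (G_regular i j z1)).2.
  have -> : z^* = z by apply/conj_Creal/Im0_real.
  by rewrite subrr mulr0.
- rewrite ltcR => y0; apply/nsdmx_Im_geP => [|u]; first exact: mxval_sym.
  by have := H u z z1; rewrite nmulr_rle0.
Qed.

(** That F is real on the positive axis is automatic, its entries being quotients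
of real polynomials. *)
Lemma DPR_rformP : DPR F <->
  forall u z, 1 < sqn z -> 0 <= Re (rform u (mxval F z)).
Proof.
split=> [[_ _ H] u z z1|H].
  have := H z; rewrite normC_gt1 => /(_ z1).
  by move=> /(psdmx_Re_geP (mxval_shifted_sym z1)).
split=> [|x x0 Fx|z]; first exact/mxanalytic_shifted.
  apply/mxOverP => i j; rewrite mxE; apply/CrealP.
  have Fr : ratreal (F i j).
    by rewrite shiftedE; apply: ratreal_shifted; rewrite ?mxval_real_N1.
  have Fx' : ~~ ratpole (F i j) x.
    by apply: contra Fx => p; apply/existsP; exists i; apply/existsP; exists j.
  by rewrite -(ratval_conj Fr Fx').2 conj_Creal// gtr0_real.
rewrite normC_gt1 => z1; apply/psdmx_Re_geP => [|u]; first exact: mxval_shifted_sym.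
exact: H.
Qed.

End Analytic.

End TransferFunction.

Theorem lemma16 (R : realType) (m : nat) (G : ratmx (complexes R) m)
    (Gsym : mxsymmetric G) (Greal : mxreal G) (Gproper : mxproper G)
    (Gpole : ~~ mxpole G (-1)) :
  let F : ratmx (complexes R) m :=
    ratfrac ('X - 1) ('X + 1) *: (G - map_mx (@ratconst _) (mxval G (-1))) in
  DNI G <-> (DPR F /\ mxval_infty G = (mxval_infty G)^T).
Proof.
move=> F; split=> [GNI|[FPR _]].
  have Gan : mxanalytic G by case: GNI.
  split; last exact: mxval_infty_sym.
  apply/(DPR_rformP Gsym Greal Gpole Gan) => u z z1.
  rewrite (rform_shifted Gan u z1).
  apply: (exterior_NI_PR (rform_disc_ratio Gproper Gpole Gan u)) => //.
    exact: rform_N1_real.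
  by move/(DNI_rformP Gsym Greal Gan): GNI; apply.
have Gan : mxanalytic G by apply: (mxanalytic_shifted G).1; case: FPR.
apply/(DNI_rformP Gsym Greal Gan) => u.
apply: (exterior_PR_NI (rform_disc_ratio Gproper Gpole Gan u)).
- exact: rform_N1_real.
- by move=> z; exact: rform_mxval_conj.
- move=> z z1; rewrite -(rform_shifted Gan u z1).
  by move/(DPR_rformP Gsym Greal Gpole Gan): FPR; apply.
Qed.
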